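(* Let $P$ be a program calling a library whose code is missing, where library functions may contain allocations, no field is accessed by both the program and the library, and there are no callbacks. Let $\Pi$ be the current set of static points-to edges, let $$\tilde{M}_{\text{alloc}}=\{o\in\mathcal{O}_P\mid y\hookrightarrow o\in\Pi\text{ for some library call }x\gets m(y)\text{ in }P\},$$ and let $M_{\text{call}}$ be the set of all library call statements $x\gets m(y)$, $m\in\mathcal{M}$, of $P$. Then, with counterexamples expressed using proxy objects for concrete objects allocated in the library, the monitoring scheme $\tilde{M}_{\text{min}}=\tilde{M}_{\text{alloc}}\cup M_{\text{call}}$ is sound.
   Context: Programs. The available program $P$ is a finite set of statements over a finite set $\mathcal{V}_P$ of program (visible) variables: allocations $x\gets X()$ ($X$ a class), assignments $x\gets y$, loads $x\gets y.f$, stores $x.f\gets y$ ($f$ a field), and library calls $x\gets m(y)$, where $m\in\mathcal{M}$ is a library function (each has exactly one parameter $p_m$ and a return value $r_m$). $P$ contains no functions of its own. Control flow is not modelled: an execution runs some finite sequence of statements of $P$, starting with all variables null. Library functions (the missing code) are implemented by statements of the same kinds (allocations allowed) over their own variables (disjoint from $\mathcal{V}_P$). A call $x\gets m(y)$ assigns $y$ to $p_m$, runs the body of $m$, and then assigns $r_m$ to $x$. Disjoint fields: no field is accessed both by a load or store of $P$ and by a load or store of the library. No callbacks from the library into $P$. Objects. $\mathcal{O}_P$ is the set of allocation statements $o=(x\gets X())$ of $P$. Each execution of an allocation statement creates a fresh concrete object, said to be allocated there. The dynamic function footprint of a concrete object $\bar o$ allocated in missing code is $\phi(\bar o)=\{m\in\mathcal{M}\mid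 \bar o\text{ is returned by some call } x\gets m(y)\text{ of }P\text{ during the execution}\}$; it is an element of the set $\mathcal{P}=2^{\mathcal{M}}$ of proxy objects. The dynamic points-to edge $x\hookrightarrow a$ ($x\in\mathcal{V}_P$, $a\in\mathcal{O}_P\cup\mathcal{P}$) occurs in an execution if at some point $x$ points to a concrete object $\bar o$ that is allocated at $a\in\mathcal{O}_P$, or is allocated in missing code with $\phi(\bar o)=a$. Static analysis. Given a set of known counterexamples $\Pi_{\text{miss}}\subseteq\mathcal{V}_P\times(\mathcal{O}_P\cup\mathcal{P})$, the computed set $\Pi\subseteq\mathcal{V}_P\times(\mathcal{O}_P\cup\mathcal{P})$ is the least set such that: (1) if $o=(x\gets X())$ is in $P$ then $x\hookrightarrow o\in\Pi$; (2) if $x\gets y$ is in $P$ and $y\hookrightarrow a\in\Pi$ then $x\hookrightarrow a\in\Pi$; (3) if $x\gets y.f$ and $z.f\gets w$ are in $P$ and $y\hookrightarrow a',z\hookrightarrow a',w\hookrightarrow a\in\Pi$ then $x\hookrightarrow a\in\Pi$; (4) $\Pi_{\text{miss}}\subseteq\Pi$. Library calls are treated as no-ops. A counterexample in an execution is a dynamic points-to edge occurring in it that is not in the current $\Pi$. Monitoring. A monitoring scheme $M$ is a set of statements of $P$ of the form $x\gets *$. Each time a statement in $M$ is executed, the pair $(x\gets *,\bar o)$ is recorded, where $\bar o$ is the concrete object $x$ points to afterwards. For each recorded pair $(x\gets *,\bar o)$: if $\bar o$ was recorded at a monitored allocation statement $o$, the edge $x\hookrightarrow o$ is detected; if $\bar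 o$ was not allocated at an allocation statement of $P$, it is concluded that $\bar o$ was allocated in missing code and the edge $x\hookrightarrow\phi(\bar o)$ is detected. Detected edges not in $\Pi$ are reported. $M$ is sound if (i) for any execution in which some counterexamples occur, $M$ reports one of them, and (ii) $M$ only reports counterexamples, i.e. it reports no false positives. *)

(* Defs.v *)
From mathcomp Require Import all_boot.
From mathcomp Require Import boolp classical_sets functions cardinality.
From Stdlib Require List.

Set Implicit Arguments.
Unset Strict Implicit.
Unset Printing Implicit Defensive.

Local Open Scope classical_set_scope.

(* Statements over variables [W].  [FLoad x y f] is x <- y.f, [FStore x f y] is
   x.f <- y and [Call x m y] is x <- m(y).  Functions [m : Fn] are always
   library functions: the program has none, so callbacks cannot be written. *)
Inductive stmt (W Cls Fld Fn : Type) : Type :=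
| Alloc (x : W) (X : Cls)
| Assign (x y : W)
| FLoad (x y : W) (f : Fld)
| FStore (x : W) (f : Fld) (y : W)
| Call (x : W) (m : Fn) (y : W).

Arguments Alloc {W Cls Fld Fn} x X.
Arguments Assign {W Cls Fld Fn} x y.
Arguments FLoad {W Cls Fld Fn} x y f.
Arguments FStore {W Cls Fld Fn} x f y.
Arguments Call {W Cls Fld Fn} x m y.

Section Statements.
Context {W Cls Fld Fn : Type}.
Implicit Types st : stmt W Cls Fld Fn.

(* [Some x] exactly for the statements of the form x <- *. *)
Definition target st : option W :=
  match st with
  | Alloc x _ | Assign x _ | FLoad x _ _ | Call x _ _ => Some x
  | FStore _ _ _ => None
  end.

Definition accesses st (f : Fld) : Prop :=
  match st with
  | FLoad _ _ g | FStore _ g _ => g = f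
  | Alloc _ _ | Assign _ _ | Call _ _ _ => False
  end.

Definition is_alloc st : Prop := exists x X, st = Alloc x X.

Definition is_call st : Prop := exists x m y, st = Call x m y.

End Statements.

(* The missing code.  Its variables form a type [L] of their own, hence are
   disjoint from the program variables; they keep their values between calls. *)
Record library (L Cls Fld Fn : Type) := Library {
  param : Fn -> L;
  ret : Fn -> L;
  body : Fn -> set (stmt L Cls Fld Fn)
}.

Definition disjoint_fields (V L Cls Fld Fn : Type) (P : set (stmt V Cls Fld Fn))
    (lib : library L Cls Fld Fn) : Prop :=
  forall f, ~ ((exists2 st, P st & accesses st f) /\
               (exists m, exists2 st, body lib m st & accesses st f)).

Section StaticAnalysis.
Context {V Cls Fld Fn : Type}.
Local Notation pstmt := (stmt V Cls Fld Fn).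

Definition allocs (P : set pstmt) : set pstmt := [set o | P o /\ is_alloc o].

(* Points-to targets: allocation statements and proxy objects. *)
Inductive aobj : Type :=
| Site (o : pstmt)
| Proxy (phi : set Fn).

Definition edge : Type := (V * aobj)%type.

(* V_P x (O_P `|` 2^M) *)
Definition edges (P : set pstmt) : set edge :=
  [set e | forall o, e.2 = Site o -> allocs P o].

Inductive points_to (P : set pstmt) (Pmiss : set edge) : edge -> Prop :=
| PtAlloc x X : P (Alloc x X) -> points_to P Pmiss (x, Site (Alloc x X))
| PtAssign x y a : P (Assign x y) ->
    points_to P Pmiss (y, a) -> points_to P Pmiss (x, a)
| PtLoadStore x y z w f a' a : P (FLoad x y f) -> P (FStore z f w) ->
    points_to P Pmiss (y, a') -> points_to P Pmiss (z, a') ->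
    points_to P Pmiss (w, a) -> points_to P Pmiss (x, a)
| PtMiss e : Pmiss e -> points_to P Pmiss e.

End StaticAnalysis.

Arguments aobj : clear implicits.
Arguments edge : clear implicits.

Section Semantics.
Context {V L : eqType} {Cls : Type} {Fld : eqType} {Fn : Type}.
Local Notation pstmt := (stmt V Cls Fld Fn).
Local Notation lstmt := (stmt L Cls Fld Fn).

Inductive origin : Type :=
| InProg (o : pstmt)
| InLib.

(* Concrete objects are natural numbers and null is [None]; [org s o] is
   [None] as long as [o] is not allocated. *)
Record state := State {
  env : V + L -> option nat;
  heap : nat * Fld -> option nat;
  org : nat -> option origin
}.

Definition init : state :=
  State (fun=> None) (fun=> None) (fun=> None).

Definition set_var (s : state) (x : V + L) (v : option nat) : state :=
  State [eta env s with x |-> v] (heap s) (org s).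

Definition set_field (s : state) (o : nat) (f : Fld) (v : option nat) : state :=
  State (env s) [eta heap s with (o, f) |-> v] (org s).

Definition set_org (s : state) (o : nat) (w : origin) : state :=
  State (env s) (heap s) [eta org s with o |-> Some w].

(* Common semantics of program and library statements: [inj] embeds the
   variables, [tag] gives the origin of allocated objects and [run m] is the
   effect of the body of [m].  Dereferencing null has no transition. *)
Inductive step (lib : library L Cls Fld Fn) (run : Fn -> state -> state -> Prop)
    (W : Type) (inj : W -> V + L) (tag : stmt W Cls Fld Fn -> origin) :
    stmt W Cls Fld Fn -> state -> state -> Prop :=
| StepAlloc x X s o : org s o = None ->
    step lib run inj tag (Alloc x X) s
      (set_var (set_org s o (tag (Alloc x X))) (inj x) (Some o))
| StepAssign x y s :
    step lib run inj tag (Assign x y) s (set_var s (inj x) (env s (inj y)))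
| StepLoad x y f s o : env s (inj y) = Some o ->
    step lib run inj tag (FLoad x y f) s (set_var s (inj x) (heap s (o, f)))
| StepStore x f y s o : env s (inj x) = Some o ->
    step lib run inj tag (FStore x f y) s (set_field s o f (env s (inj y)))
| StepCall x m y s s' :
    run m (set_var s (inr (param lib m)) (env s (inj y))) s' ->
    step lib run inj tag (Call x m y) s
      (set_var s' (inj x) (env s' (inr (ret lib m)))).

(* Control flow is not modelled in the library either: running [m] executes
   some finite sequence of statements of its body. *)
Inductive run_body (lib : library L Cls Fld Fn) : Fn -> state -> state -> Prop :=
| RunNil m s : run_body lib m s s
| RunCons m st s s' s'' : body lib m st ->
    step lib (run_body lib) inr (fun=> InLib) st s s' ->
    run_body lib m s' s'' -> run_body lib m s s''.

(* The statements of the program that were run, each with the state after it.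
   Program variables do not change in the course of a library call, so these
   states (and [init], where all variables are null) are all that matters. *)
Definition trace : Type := seq (pstmt * state).

Fixpoint run_from (P : set pstmt) (lib : library L Cls Fld Fn) (s : state)
    (t : trace) : Prop :=
  match t with
  | [::] => True
  | (st, s') :: t' => [/\ P st, step lib (run_body lib) inl InProg st s s'
                       & run_from P lib s' t']
  end.

Definition execution (P : set pstmt) (lib : library L Cls Fld Fn) (t : trace) :=
  run_from P lib init t.

Definition footprint (t : trace) (o : nat) : set Fn :=
  [set m | exists x y s, List.In (Call x m y, s) t /\ env s (inl x) = Some o].

Definition occurs (t : trace) (e : edge V Cls Fld Fn) : Prop :=
  exists st s o, [/\ List.In (st, s) t, env s (inl e.1) = Some o &
    (exists2 a, org s o = Some (InProg a) & e.2 = Site a) \/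
    (org s o = Some InLib /\ e.2 = Proxy (footprint t o))].

Definition counterexample (Pi : set (edge V Cls Fld Fn)) (t : trace)
    (e : edge V Cls Fld Fn) : Prop :=
  occurs t e /\ ~ Pi e.

Definition monitoring_scheme (P M : set pstmt) : Prop :=
  forall st, M st -> P st /\ exists x, target st = Some x.

(* The pair (x <- *, o) is recorded; [s] is the state at that moment. *)
Definition recorded (M : set pstmt) (t : trace) (st : pstmt) (x : V) (o : nat)
    (s : state) : Prop :=
  [/\ M st, List.In (st, s) t, target st = Some x & env s (inl x) = Some o].

Definition detected (P M : set pstmt) (t : trace) (e : edge V Cls Fld Fn) :
    Prop :=
  exists st o s, recorded M t st e.1 o s /\
    ((exists a y s', [/\ is_alloc a, recorded M t a y o s' & e.2 = Site a]) \/
     ((forall a, allocs P a -> org s o <> Some (InProg a)) /\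
      e.2 = Proxy (footprint t o))).

Definition reported (P M : set pstmt) (Pi : set (edge V Cls Fld Fn))
    (t : trace) (e : edge V Cls Fld Fn) : Prop :=
  detected P M t e /\ ~ Pi e.

Definition sound (P : set pstmt) (lib : library L Cls Fld Fn)
    (Pi : set (edge V Cls Fld Fn)) (M : set pstmt) : Prop :=
  (forall t, execution P lib t -> (exists e, counterexample Pi t e) ->
     exists e, counterexample Pi t e /\ reported P M Pi t e) /\
  (forall t, execution P lib t ->
     forall e, reported P M Pi t e -> counterexample Pi t e).

End Semantics.

Section Scheme.
Context {V Cls Fld Fn : Type}.
Local Notation pstmt := (stmt V Cls Fld Fn).

Definition M_alloc (P : set pstmt) (Pi : set (edge V Cls Fld Fn)) : set pstmt :=
  [set o | allocs P o /\ exists x m y, P (Call x m y) /\ Pi (y, Site o)].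

Definition M_call (P : set pstmt) : set pstmt := [set st | P st /\ is_call st].

End Scheme.

(* Main.v *)
Require Import Defs.
From mathcomp Require Import all_boot.
From mathcomp Require Import boolp classical_sets functions cardinality.

(** Suppose every detected edge is already in [Pi]. By induction on the
    execution, every program variable then points only along edges of [Pi], and
    every program object held by the library was allocated at a statement of
    [M_alloc]: it entered through the argument [y] of a call, and [y] points to
    its site in [Pi]. Program loads only read what program stores wrote, as the
    fields are disjoint, so rule (3) covers them; an object returned by a call
    is either from the library or was recorded at its allocation, so its edge is
    detected at the call and lies in [Pi]. Conversely, a detected edge occurs
    because the origin of an object never changes. *)

Local Open Scope classical_set_scope.

Section Soundness.
Set Implicit Arguments.
Unset Strict Implicit.

Context {V L : eqType} {Cls : Type} {Fld : eqType} {Fn : Type}.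
Context (P : set (stmt V Cls Fld Fn)) (lib : library L Cls Fld Fn).
Local Notation state := (@state V L Cls Fld Fn).
Local Notation trace := (@trace V L Cls Fld Fn).
Local Notation origin := (@origin V Cls Fld Fn).
Local Notation edge := (edge V Cls Fld Fn).
Implicit Types (s : state) (t : trace) (Q : set edge).

Lemma step_mono (run run' : Fn -> state -> state -> Prop) (W : Type)
    (inj : W -> V + L) (tag : stmt W Cls Fld Fn -> origin) st s s' :
  (forall m s1 s2, run m s1 s2 -> run' m s1 s2) ->
  step lib run inj tag st s s' -> step lib run' inj tag st s s'.
Proof.
move=> le_run; case=> *; [exact: StepAlloc|exact: StepAssign|exact: StepLoad
  |exact: StepStore|by apply: StepCall; apply: le_run].
Qed.

(* The generated principle has no hypothesis for calls nested in a step. *)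
Lemma run_body_nested_ind (R : Fn -> state -> state -> Prop) :
  (forall m s, R m s s) ->
  (forall m st s s' s'', body lib m st -> step lib R inr (fun=> InLib) st s s' ->
     R m s' s'' -> R m s s'') ->
  forall m s s', run_body lib m s s' -> R m s s'.
Proof.
move=> Rnil Rcons; fix IH 4 => m s s' [{}m {}s|{}m st {}s s1 s2 mst st_s run_s].
  exact: Rnil.
apply: (Rcons m st s s1 s2 mst _ (IH _ _ _ run_s)).
(* The step is taken apart in place so that [run0] is visibly a subterm and the recursive call is
   guarded. *)
by case: st_s => [x X s0 o os|x y s0|x y f s0 o|x f y s0 o|x m0 y s0 s0' run0];
  [exact: StepAlloc|exact: StepAssign|exact: StepLoad|exact: StepStore
  |apply: StepCall; exact: IH run0].
Qed.

(** * Persistence of origins *)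

Definition org_le s s' : Prop :=
  forall o w, org s o = Some w -> org s' o = Some w.

Lemma org_le_set_org s o w : org s o = None -> org_le s (set_org s o w).
Proof. by move=> os o' w' /=; case: eqP => [->|//]; rewrite os. Qed.

Lemma step_org_le (run : Fn -> state -> state -> Prop) (W : Type)
    (inj : W -> V + L) (tag : stmt W Cls Fld Fn -> origin) st s s' :
  (forall m s1 s2, run m s1 s2 -> org_le s1 s2) ->
  step lib run inj tag st s s' -> org_le s s'.
Proof.
move=> le_run; case=> [x X {}s o os|x y {}s|x y f {}s o _|x f y {}s o _
  |x m y {}s {}s' run_m] //; first exact: org_le_set_org os.
exact: le_run run_m.
Qed.

Lemma run_body_org_le m s s' : run_body lib m s s' -> org_le s s'.
Proof.
move: m s s'; apply: run_body_nested_ind => [m s o w //|m st s s' s'' _ st_s le_s' o w].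
by move=> /(step_org_le (fun _ _ _ le => le) st_s); apply: le_s'.
Qed.

(** Lets two states of a trace be compared whatever their order: origins known in either one survive
    to the last state. *)
Lemma run_from_org_le s t st s' : run_from P lib s t ->
  List.In (st, s') t -> org_le s s' /\ org_le s' (last s (unzip2 t)).
Proof.
elim: t s st s' => //= -[st1 s1] t IH s st s' [_ st_s run_t].
have le_s1 := step_org_le run_body_org_le st_s.
have le_last : org_le s1 (last s1 (unzip2 t)).
  case: t run_t IH => [_ _ o w //|[st2 s2] t run_t /(_ _ st2 s2 run_t) [|le2 le]].
    by left.
  by move=> o w /le2 /le.
case=> [[_ <-] //|/(IH _ _ _ run_t) [le1 le2]]; split=> // o w.
by move=> /le_s1 /le1.
Qed.

Lemma run_from_step s t st s' : run_from P lib s t -> List.In (st, s') t ->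
  exists s0, step lib (run_body lib) inl InProg st s0 s'.
Proof.
elim: t s => //= -[st1 s1] t IH s [_ st_s run_t] [[<- <-]|]; first by exists s.
exact: IH run_t.
Qed.

(** * The invariant of an execution *)

Section Invariant.
Context (Q : set edge) (t : trace).

(** The footprint is that of the complete trace [t], even at intermediate states, so an object keeps
    its abstraction once allocated. *)
Definition abs_obj (o : nat) (w : origin) : aobj V Cls Fld Fn :=
  match w with InProg a => Site a | InLib => Proxy (footprint t o) end.

Definition abs_edge s (x : V) (o : nat) : Prop :=
  exists2 w, org s o = Some w & Q (x, abs_obj o w).

(** For a program object, the condition under which [M_alloc] contains its site when [Q] is [Pi]. *)
Definition lib_ok s (o : nat) : Prop :=
  exists2 w, org s o = Some w &
    forall a, w = InProg a -> exists x m y, P (Call x m y) /\ Q (y, Site a).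

(** Remembers a store that accounts for the cell, as rule (3) will ask for it at a later load. *)
Definition prog_cell s (o : nat) (f : Fld) (v : nat) : Prop :=
  exists z w, [/\ P (FStore z f w), abs_edge s z o & abs_edge s w v].

Definition lib_field (f : Fld) : Prop :=
  exists m, exists2 st, body lib m st & accesses st f.

Definition alloc_in_trace (o : nat) (a : stmt V Cls Fld Fn) : Prop :=
  exists x X s, [/\ a = Alloc x X, P a, List.In (a, s) t & env s (inl x) = Some o].

Record invariant s : Prop := Invariant {
  inv_prog : forall x o, env s (inl x) = Some o -> abs_edge s x o;
  inv_lib : forall x o, env s (inr x) = Some o -> lib_ok s o;
  inv_heap : forall o f v, heap s (o, f) = Some v ->
    prog_cell s o f v \/ lib_field f /\ lib_ok s v;
  inv_org : forall o a, org s o = Some (InProg a) -> alloc_in_trace o a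
}.

Lemma invariant_init : invariant (init : state).
Proof. by []. Qed.

Lemma invariant_set_prog_var s x v : invariant s ->
  (forall o, v = Some o -> abs_edge s x o) -> invariant (set_var s (inl x) v).
Proof.
case=> ip il ih io xv; split; [move=> /= y o|exact: il|exact: ih|exact: io].
by case: eqP => [[->] /xv|_ /ip].
Qed.

Lemma invariant_set_lib_var s x v : invariant s ->
  (forall o, v = Some o -> lib_ok s o) -> invariant (set_var s (inr x) v).
Proof.
case=> ip il ih io xv; split; [exact: ip|move=> /= y o|exact: ih|exact: io].
by case: eqP => [_ /xv|_ /il].
Qed.

Lemma invariant_set_field s o f v : invariant s ->
  (forall o', v = Some o' -> prog_cell s o f o' \/ lib_field f /\ lib_ok s o') ->
  invariant (set_field s o f v).
Proof.
case=> ip il ih io xv; split; [exact: ip|exact: il|move=> /= o1 f1 v1|exact: io].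
by case: eqP => [[-> ->] /xv|_ /ih].
Qed.

Lemma invariant_set_org s o w : invariant s -> org s o = None ->
  (forall a, w = InProg a -> alloc_in_trace o a) -> invariant (set_org s o w).
Proof.
move=> [ip il ih io] os ow; have le := org_le_set_org w os.
have leA x o' : abs_edge s x o' -> abs_edge (set_org s o w) x o'.
  by case=> w' /le; exists w'.
have leL o' : lib_ok s o' -> lib_ok (set_org s o w) o'.
  by case=> w' /le; exists w'.
split=> /=.
- by move=> x o' /ip /leA.
- by move=> x o' /il /leL.
- move=> o' f v /ih [[z [y [Pzy /leA zo /leA yv]]]|[ff /leL vok]].
    by left; exists z, y.
  by right.
- by move=> o' a; case: eqP => [-> [/ow]|_ /io].
Qed.

Hypothesis fieldsP : disjoint_fields P lib.

Lemma invariant_run_body m s s' :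
  run_body lib m s s' -> invariant s -> invariant s'.
Proof.
move: m s s'; apply: run_body_nested_ind => // m st s s' s'' mst st_s IH inv_s.
apply: IH; case: st_s mst inv_s => {st s s'}.
- move=> x X s o os _ inv_s; apply: invariant_set_lib_var => [|_ [<-]].
    exact: invariant_set_org.
  by exists InLib => //=; rewrite eqxx.
- move=> x y s _ inv_s; apply: invariant_set_lib_var => // o.
  exact: inv_lib.
- move=> x y f s o yo bst inv_s; apply: invariant_set_lib_var => // v.
  (* A cell written by the program would make [f] a field of both sides. *)
  case/(inv_heap inv_s) => [[z [w [Pzw _ _]]]|[]//].
  case: (@fieldsP f); split; last by exists m; exists (FLoad x y f).
  by exists (FStore z f w).
- move=> x f y s o xo bst inv_s; apply: invariant_set_field => // v.
  move=> /(inv_lib inv_s) vok; right; split=> //.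
  by exists m; exists (FStore x f y).
- move=> x m' y s s' run_m _ inv_s.
  have inv_s' : invariant s'.
    (* Here [run_m] is the induction hypothesis for the nested call. *)
    by apply: run_m; apply: invariant_set_lib_var => // o; apply: inv_lib.
  by apply: invariant_set_lib_var => // o; apply: inv_lib.
Qed.

(* With [Q] in place of [Pmiss], this says that [Q] is closed under (1)-(3). *)
Hypothesis closedQ : points_to P Q `<=` Q.
(** Rules (1)-(3) treat calls as no-ops, so the edge of a returned object has to come from
    elsewhere; for [Pi] it comes from monitoring. *)
Hypothesis returnQ : forall x m y s o, P (Call x m y) ->
  List.In (Call x m y, s) t -> env s (inl x) = Some o -> lib_ok s o ->
  (forall a, org s o = Some (InProg a) -> alloc_in_trace o a) -> abs_edge s x o.

Lemma invariant_prog_step st s s' : P st -> List.In (st, s') t ->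
  step lib (run_body lib) inl InProg st s s' -> invariant s -> invariant s'.
Proof.
move=> Pst + st_s; case: st_s Pst => {st s s'}.
- move=> x X s o os Pst tst inv_s; apply: invariant_set_prog_var => [|_ [<-]].
    apply: invariant_set_org => // _ [<-]; do 3 eexists; split=> //; first exact: tst.
    by rewrite /= eqxx.
  exists (InProg (Alloc x X)); first by rewrite /= eqxx.
  by apply: closedQ; apply: PtAlloc.
- move=> x y s Pst _ inv_s; apply: invariant_set_prog_var => // o.
  case/(inv_prog inv_s) => w ow Qw; exists w => //.
  by apply: closedQ; apply: PtAssign Pst _; apply: PtMiss.
- move=> x y f s o yo Pst _ inv_s; apply: invariant_set_prog_var => // v.
  case/(inv_heap inv_s) => [[z [w [Pzw [a oa Qz] [b vb Qw]]]]|[libf _]].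
    exists b => //; apply: closedQ.
    (* The object [o] has a single origin, so [y] and [z] share an abstract object and rule (3)
       applies. *)
    case: (inv_prog inv_s yo) => a'; rewrite oa => -[<-] Qy.
    by apply: (PtLoadStore (y := y) (z := z) (a' := abs_obj o a) Pst Pzw);
      apply: PtMiss.
  by case: (@fieldsP f); split=> //; exists (FLoad x y f).
- move=> x f y s o xo Pst _ inv_s; apply: invariant_set_field => // v.
  move=> /(inv_prog inv_s) yv; left; exists x, y; split=> //.
  exact: inv_prog xo.
- move=> x m y s s' run_m Pst tst inv_s.
  have inv_s' : invariant s'.
    apply: (invariant_run_body run_m); apply: invariant_set_lib_var => // o.
    (* This very call witnesses [lib_ok] for its argument. *)
    case/(inv_prog inv_s) => w ow Qw; exists w => // a wa.
    by exists x, m, y; move: Qw; rewrite wa.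
  apply: invariant_set_prog_var => // o ro.
  apply: (returnQ Pst tst); first by rewrite /= eqxx.
    exact: inv_lib ro.
  by move=> a /= oa; apply: inv_org oa.
Qed.

Lemma invariant_execution st s : execution P lib t -> List.In (st, s) t ->
  invariant s.
Proof.
rewrite /execution => run_t.
(* The induction is on the remaining run [t'], while footprints still refer to the whole of [t]. *)
suff: forall t' s0, List.incl t' t -> run_from P lib s0 t' -> invariant s0 ->
    List.In (st, s) t' -> invariant s.
  by move=> H; apply: H (List.incl_refl t) run_t invariant_init.
elim=> //= -[st1 s1] t' IH s0 t't [Pst1 st1_s run_t'] inv_s0.
have inv_s1 : invariant s1.
  by apply: invariant_prog_step st1_s inv_s0 => //; apply: t't; left.
case=> [[_ <-] //|]; apply: IH run_t' inv_s1.
by move=> e et'; apply: t't; right.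
Qed.

End Invariant.

(** * Detected and occurring edges *)

Lemma occurs_abs t st s x o w : List.In (st, s) t -> env s (inl x) = Some o ->
  org s o = Some w -> occurs t (x, abs_obj t o w).
Proof.
move=> tst xo ow; exists st, s, o; split=> //.
by case: w ow => [a|] ow; [left; exists a|right].
Qed.

Lemma detected_occurs M t e : disjoint_fields P lib -> execution P lib t ->
  detected P M t e -> occurs t e.
Proof.
move=> fieldsP run_t.
(* With [Q] the full set, the invariant retains what is needed about origins: objects in use have
   one, and program sites were run. *)
have inv st s : List.In (st, s) t -> invariant setT t s.
  apply: invariant_execution => // x m y s0 o _ _ _ [w ow _] _.
  by exists w.
case: e => x e2 [st [o [s [[_ tst _ xo]]]]] /=.
have [w ow _] := inv_prog (inv _ _ tst) xo.
case=> [[a [y [s' [[z [X aE]] [_ ta ay yo] ->]]]]|[noprog ->]]; last first.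
  case: w ow => [a|] ow; last exact: occurs_abs tst xo ow.
  have [z [X [_ [aE Pa _ _]]]] := inv_org (inv _ _ tst) ow.
  by case: (noprog a) => //; split=> //; exists z, X.
suff ->: Site a = abs_obj t o w by apply: occurs_abs tst xo ow.
(* Right after the allocation [a], its target holds the object just created. *)
have oa : org s' o = Some (InProg a).
  have [s0 st_s0] := run_from_step run_t ta; move: ay yo; rewrite aE.
  rewrite aE in st_s0; inversion st_s0; subst => -[<-] /=; rewrite eqxx => -[<-].
  by rewrite eqxx.
have [_ /(_ _ _ ow)] := run_from_org_le run_t tst.
by have [_ /(_ _ _ oa) ->] := run_from_org_le run_t ta; case=> <-.
Qed.

(** Provides [closedQ] for [Pi]. *)
Lemma points_to_idem (Pmiss : set edge) :
  points_to P (points_to P Pmiss) `<=` points_to P Pmiss.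
Proof.
move=> e; elim=> {e}; [exact: PtAlloc| | |by []].
  by move=> x y a Pxy _; apply: PtAssign.
by move=> x y z w f a' a Pxy Pzw _ yp _ zp _ wp; apply: PtLoadStore yp zp wp; eassumption.
Qed.

Lemma occurs_sub_of_detected_sub (Pmiss : set edge) t :
  let Pi := points_to P Pmiss in
  disjoint_fields P lib -> execution P lib t ->
  detected P (M_alloc P Pi `|` M_call P) t `<=` Pi -> occurs t `<=` Pi.
Proof.
move=> Pi fieldsP run_t detPi [x e2] [st [s [o [tst xo /= e2E]]]].
have returnPi z m y s0 v : P (Call z m y) -> List.In (Call z m y, s0) t ->
    env s0 (inl z) = Some v -> lib_ok Pi s0 v ->
    (forall a, org s0 v = Some (InProg a) -> alloc_in_trace t v a) ->
    abs_edge Pi t s0 z v.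
  move=> Pst tst0 zv [w vw wcall] vorg; exists w => //; apply: detPi.
  exists (Call z m y), v, s0; split; first by split=> //; right; split=> //; exists z, m, y.
  (* A library object is detected through its proxy; a program object was recorded at its site,
     which [wcall] puts in [M_alloc]. *)
  case: w vw wcall => [a|] vw wcall; last by right; split=> // a _; rewrite vw.
  have [z' [X [s' [aE Pa ta z'v]]]] := vorg a vw.
  have aA : is_alloc a by exists z', X.
  left; exists a, z', s'; split=> //; split=> //; last by rewrite aE.
  by left; split; [|exact: wcall].
have [w ow] := inv_prog (invariant_execution fieldsP
  (@points_to_idem Pmiss) returnPi run_t tst) xo.
by case: e2E => [[a]|[]]; rewrite ow => -[->] ->.
Qed.

End Soundness.

Theorem proposition7 (V : finType) (L : eqType) (Cls : Type) (Fld : eqType)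
    (Fn : Type) (P : set (stmt V Cls Fld Fn)) (lib : library L Cls Fld Fn)
    (Pmiss : set (edge V Cls Fld Fn)) :
  finite_set P ->
  disjoint_fields P lib ->
  Pmiss `<=` edges P ->
  let Pi : set (edge V Cls Fld Fn) := points_to P Pmiss in
  let M_min : set (stmt V Cls Fld Fn) := M_alloc P Pi `|` M_call P in
  monitoring_scheme P M_min /\ sound P lib Pi M_min.
Proof.
move=> _ fieldsP _ Pi M_min; split.
  by move=> st [[[Pst [x [X stE]]] _]|[Pst [x [m [y stE]]]]]; split=> //;
    exists x; rewrite stE.
split=> t run_t; [move=> [e [occ_e notPi_e]]|move=> e [det_e notPi_e]]; last first.
  by split=> //; apply: detected_occurs det_e.
(* If no counterexample is reported, then all detected edges, which do occur, lie in [Pi], and hence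
   so does [e]. *)
apply: contrapT => none; apply: notPi_e.
apply: (occurs_sub_of_detected_sub fieldsP run_t _ occ_e) => e' det_e'.
apply: contrapT => notPi_e'; apply: none; exists e'.
by do 2 split=> //; apply: detected_occurs det_e'.
Qed.
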